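(* Let $(X,E)$ be a finite connected graph and $B\subset X$ be a subset of vertices such that $(X,E)$ satisfies the Two-Points Condition with respect to $B$. Consider an admissible random walk on $(X,E)$ with coefficients $c_{xy}$ and transition matrix $(p_{xy})_{x,y\in X}$. Then the first passing time probabilities $\mathbb{P}(\{\tau^+(x_0,y)=t\})$, for all $x_0,y\in B$ and $t\in\mathbb{Z}_+$, determine the graph $(X,E)$ and the weights $c_{xy}$ ($x,y\in X$) up to a constant multiple. As a consequence, the transition matrix is uniquely recovered. Precisely: let $(X',E')$ be another finite connected graph satisfying the Two-Points Condition with respect to $B'\subset X'$, with an admissible random walk with coefficients $c'$, transition matrix $p'$ and first passing times $\tau'^+$. Let $\Phi_0:B\to B'$ be a bijection such that $\mathbb{P}(\{\tau^+(x_0,y)=t\})=\mathbb{P}(\{\tau'^+(\Phi_0(x_0),\Phi_0(y))=t\})$ for all $x_0,y\in B$, $t\in\mathbb{Z}_+$. Then there exist a graph isomorphism $\Phi:(X,E)\to(X',E')$ with $\Phi|_B=\Phi_0$ and a constant $A>0$ such that $c'_{\Phi(x)\Phi(y)}=A\,c_{xy}$ for all $x,y\in X$ with $x\sim y$ or $x=y$. Consequently $p'_{\Phi(x)\Phi(y)}=p_{xy}$ for all $x,y\in X$.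
   Context: Graphs are finite, undirected and simple; $x\sim y$ means $\{x,y\}\in E$; $\mathbb{N}=\{0,1,2,\dots\}$, $\mathbb{Z}_+=\{1,2,\dots\}$. Admissible random walk on $(X,E)$: for $x_0\in X$, $H_t^{x_0}$, $t\in\mathbb{N}$, is a homogeneous discrete-time Markov chain with state space $X$, $H_0^{x_0}=x_0$, and transition probabilities $p_{xy}=\mathbb{P}(H_{t+1}^{x_0}=y\mid H_t^{x_0}=x)$ satisfying: (1) $p_{xy}=0$ unless $x\sim y$ or $x=y$; (2) for $x\sim y$ or $x=y$, $p_{xy}=c_{xy}/m(x)$ with $m(x)=\sum_{z\sim x\text{ or }z=x}c_{xz}$ (so $m(x)>0$), where $c_{xy}=c_{yx}>0$ for all $x\sim y$, and $c_{xx}\ge 0$ for all $x\in X$ ($c_{xx}$ may be zero). First passing time: $\tau^+(x_0,y)=\inf\{t\ge 1: H_t^{x_0}=y\}\in\mathbb{Z}_+\cup\{\infty\}$. The graph distance between two vertices is the minimal number of edges of a path joining them. Given $S\subset X$, a point $x_0\in S$ is an extreme point of $S$ with respect to $B$ if there exists $b\in B$ (possibly $b=x_0$) such that $x_0$ is the unique nearest point in $S$ from $b$ with respect to the graph distance. $(X,E)$ satisfies the Two-Points Condition with respect to $B$ if every subset $S\subset X$ with cardinality at least $2$ has at least two extreme points with respect to $B$. *)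

(* Defs.v *)
From HB Require Import structures.
From mathcomp Require Import all_boot all_order all_algebra.
From mathcomp Require Import all_classical all_reals all_analysis.

Set Implicit Arguments.
Unset Strict Implicit.
Unset Printing Implicit Defensive.

Import Order.TTheory GRing.Theory Num.Theory.

Definition simple_graph (X : finType) (e : rel X) : Prop :=
  symmetric e /\ irreflexive e.

(* The empty graph is not considered connected. *)
Definition connected_graph (X : finType) (e : rel X) : Prop :=
  (0 < #|X|)%N /\ forall x y : X, connect e x y.

Definition has_path (X : finType) (e : rel X) (x y : X) (n : nat) : bool :=
  [exists s : n.-tuple X, [&& path e x s, uniq (x :: s) & last x s == y]].

(* A path has distinct vertices, hence fewer than #|X| edges, so bounding the
   index loses nothing; the default value #|X| only occurs when no path joins
   x and y. *)
Definition gdist (X : finType) (e : rel X) (x y : X) : nat :=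
  \big[minn/#|X|]_(n < #|X| | has_path e x y n) n.

Definition unique_nearest (X : finType) (e : rel X) (S : {set X}) (b x0 : X)
    : bool :=
  (x0 \in S) && [forall x in S, (x != x0) ==> (gdist e b x0 < gdist e b x)%N].

Definition extreme_point (X : finType) (e : rel X) (B S : {set X}) (x0 : X)
    : bool :=
  [exists b in B, unique_nearest e S b x0].

Definition two_points_condition (X : finType) (e : rel X) (B : {set X})
    : Prop :=
  forall S : {set X}, (2 <= #|S|)%N ->
    (2 <= #|[pred x0 | extreme_point e B S x0]|)%N.

Local Open Scope classical_set_scope.
Local Open Scope ring_scope.

Definition adj_or_eq (X : finType) (e : rel X) : rel X :=
  fun x y => e x y || (x == y).

Definition vertex_weight (R : realType) (X : finType) (e : rel X)
    (c : X -> X -> R) (x : X) : R :=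
  \sum_(z | adj_or_eq e x z) c x z.

(* The values of c at distinct non-adjacent vertices are irrelevant. *)
Definition admissible (R : realType) (X : finType) (e : rel X)
    (c p : X -> X -> R) : Prop :=
  [/\ forall x y, e x y -> c x y = c y x /\ 0 < c x y,
      forall x, 0 <= c x x,
      forall x, 0 < vertex_weight e c x,
      forall x y, ~~ adj_or_eq e x y -> p x y = 0
    & forall x y, adj_or_eq e x y -> p x y = c x y / vertex_weight e c x].

Definition cond_prob (R : realType) (d : measure_display)
    (T : measurableType d) (P : probability T R) (A C : set T) : R :=
  fine (P (A `&` C)) / fine (P C).

(* The preimages of points suffice for measurability, X being finite and
   discrete. Conditional probabilities are only constrained when the
   conditioning event has positive probability. *)
Definition markov_chain (R : realType) (d : measure_display)
    (T : measurableType d) (P : probability T R) (X : finType)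
    (p : X -> X -> R) (x0 : X) (H : nat -> T -> X) : Prop :=
  [/\ forall t y, measurable [set w | H t w = y],
      forall w, H 0%N w = x0,
      forall (t : nat) (h : nat -> X) (y : X),
        let past := [set w | forall s, (s <= t)%N -> H s w = h s] in
        (0 < P past)%E ->
        cond_prob P [set w | H t.+1 w = y] past =
        cond_prob P [set w | H t.+1 w = y] [set w | H t w = h t]
    & forall (t : nat) (x y : X),
        (0 < P [set w | H t w = x])%E ->
        cond_prob P [set w | H t.+1 w = y] [set w | H t w = x] = p x y].

(* Extended-real valued; the infimum of the empty set is +oo. *)
Definition first_passing_time (R : realType) (T : Type) (X : finType)
    (H : nat -> T -> X) (y : X) (w : T) : \bar R :=
  ereal_inf [set (t%:R%:E : \bar R) | t in [set t | (1 <= t)%N /\ H t w = y]].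

(* Main.v *)
Require Import Defs.
From HB Require Import structures.
From mathcomp Require Import all_boot all_order all_algebra.
From mathcomp Require Import all_classical all_reals all_analysis.
From mathcomp Require Import ring.

Set Implicit Arguments.
Unset Strict Implicit.
Unset Printing Implicit Defensive.

Import Order.TTheory GRing.Theory Num.Theory.
Local Open Scope classical_set_scope.
Local Open Scope ring_scope.

(** Write [f P] for the distribution at time 1 of the walk started from the
distribution [f]; functions on the vertices are treated as signed measures.

The first passing probabilities between observers (vertices of [B]) give, by
the renewal equation, the n-step transition probabilities between observers.
So the linear relation that pairs [delta_b P^n] on [X] with
[delta_b' P'^n] on [X'], where [b' = Phi0 b], makes sense: call paired measures
twins. By construction twins have the same observations at all times. They have
the same total mass, and, after scaling the weights so that they agree on the
observers, the same scalar products for the inner products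
[sum_x f x g x / m x], for which [P] and [P'] are self-adjoint. What remains is
to show that the twin of a unit mass is a unit mass: then twinning is a
bijection of vertices, the norms of unit masses identify the weights [m], and
the scalar products of unit masses with unit masses evolved by one step identify
the transition matrices, hence the edges and the coefficients.

The Two-Points Condition enters in two ways, through the fact that a unit mass
at [x] is first seen at [b] at time [gdist b x].
- Isolation: in a nonempty set [S] some vertex [x0] is the unique nearest one
  to an observer [b]. When the walk started at [b] first reaches [x0], it charges no
  other vertex of [S].
- Separation: a signed measure that stays invisible to every observer as long
  as the unit mass at [x] does is a multiple of that unit mass. Otherwise the
  support of the measure, with [x] added, has an extreme point other than [x],
  and the mass there is seen too early and without cancellation.

Let [S] be the set of vertices whose unit mass is not the twin of a unit mass,
and suppose that it is nonempty. Isolation writes the unit mass at some [x0] in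
[S] as a positive multiple of [delta_b P^n] minus its part outside [S], so that
its twin [g] agrees, up to a positive factor, with the nonnegative measure
[delta_b' P'^n] off the vertices already matched; on these [g] vanishes, by
orthogonality. Hence [g] is nonnegative, and of mass 1, so that it charges some
[y]. No cancellation being possible, the unit mass at [y] is invisible whenever
[g] is, that is, whenever the unit mass at [x0] is. By separation the twin of
the unit mass at [y] is the unit mass at [x0], a contradiction. *)

(** * Graph distance *)

Lemma bigminn_le_cond (k j : nat) (P : pred nat) :
  (j < k)%N -> P j -> (\big[minn/k]_(n < k | P n) n <= j)%N.
Proof.
move=> jk Pj; rewrite (eq_bigr (fun n : 'I_k => nat_of_ord n)) //.
exact: (@bigmin_le_cond _ nat _ k (Ordinal jk) (fun n => P n) _ Pj).
Qed.

Section Distance.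
Variables (X : finType) (e : rel X).

Lemma gdist_le_path x s : path e x s ->
  (gdist e x (last x s) <= size s)%N /\ (gdist e x (last x s) < #|X|)%N.
Proof.
move=> exs; case/shortenP: exs => s' exs' us' ss'.
have sX : (size s' < #|X|)%N.
  by have := max_card [in x :: s']; rewrite (card_uniqP us').
have ds' : (gdist e x (last x s') <= size s')%N.
  apply: bigminn_le_cond => //; apply/existsP; exists (in_tuple s') => /=.
  by rewrite exs' -/(uniq (x :: s')) us' eqxx.
split; last exact: leq_ltn_trans ds' sX.
by apply: leq_trans ds' _; apply: uniq_leq_size => //; case/andP: us'.
Qed.

Hypothesis conn_e : forall x y : X, connect e x y.

(** In a connected graph the default value of the minimum is not attained, so
that the distance is the length of a path. *)
Lemma gdist_path x y :
  exists2 s, path e x s & last x s = y /\ size s = gdist e x y.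
Proof.
have Q n : (\big[minn/#|X|]_(n < #|X| | has_path e x y n) n = n)%N ->
    n = #|X| \/ has_path e x y n.
  move<-; elim/big_ind: _ => [|a b [->|ha] [->|hb]|i]; try by auto.
  - by left; rewrite minnn.
  - by case: leqP; auto.
  - by case: leqP; auto.
  - by case: leqP; auto.
case: (Q _ erefl) => [dX|/existsP[s /and3P[exs _ /eqP lsy]]]; last first.
  by exists s => //; rewrite size_tuple.
have /connectP[s exs ysE] := conn_e x y.
by have [_] := gdist_le_path exs; rewrite -ysE /gdist dX ltnn.
Qed.

Lemma gdist_adj x y z : adj_or_eq e y z -> (gdist e x z <= (gdist e x y).+1)%N.
Proof.
case/orP=> [eyz|/eqP->] //.
have [s exs [lsy <-]] := gdist_path x y.
have /gdist_le_path[] : path e x (rcons s z) by rewrite rcons_path exs lsy.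
by rewrite last_rcons size_rcons.
Qed.

Hypothesis sym_e : symmetric e.

Lemma gdist_sym x y : gdist e x y = gdist e y x.
Proof.
wlog suff le : x y / (gdist e x y <= gdist e y x)%N.
  by apply/eqP; rewrite eqn_leq !le.
have [s exs [lsx <-]] := gdist_path y x.
have /gdist_le_path[] : path e x (rev (belast y s)).
  by rewrite -lsx rev_path (eq_path (e' := e)) // => u v; rewrite sym_e.
case: s exs lsx => [|z s] /= _ lsx; first by rewrite lsx.
by rewrite rev_cons last_rcons size_rcons size_rev size_belast.
Qed.

End Distance.

(** * Evolution of signed measures under a transition matrix *)

Section Evolution.
Variables (R : realType) (X : finType).
Implicit Types (p : X -> X -> R) (f g : X -> R).

Definition point (x : X) : X -> R := fun y => (y == x)%:R.

Definition evol p f : X -> R := fun y => \sum_x f x * p x y.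

Definition law p n x : X -> R := iter n (evol p) (point x).

Lemma sum_point x f : \sum_y point x y * f y = f x.
Proof.
rewrite (bigD1 x) //= big1 ?addr0 /point ?eqxx ?mul1r // => y /negPf->.
by rewrite mul0r.
Qed.

Lemma mass_point x : \sum_y point x y = 1.
Proof.
by rewrite -[RHS](sum_point x (fun=> 1)); apply: eq_bigr => *; rewrite mulr1.
Qed.

Lemma iter_evol_lin p n a f g y :
  iter n (evol p) (fun x => a * f x + g x) y =
  a * iter n (evol p) f y + iter n (evol p) g y.
Proof.
elim: n y => //= n IHn y.
rewrite /evol mulr_sumr -big_split /=; apply: eq_bigr => x _.
by rewrite IHn mulrDl mulrA.
Qed.

Lemma iter_evolE p n f y : iter n (evol p) f y = \sum_x f x * law p n x y.
Proof.
elim: n y => [|n IHn] y /=.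
  rewrite -[LHS](sum_point y); apply: eq_bigr => x _.
  by rewrite /law /point /= mulrC eq_sym.
transitivity (\sum_z \sum_x f x * law p n x z * p z y).
  by apply: eq_bigr => z _; rewrite IHn mulr_suml.
rewrite exchange_big /=; apply: eq_bigr => x _.
by rewrite [in RHS]/evol mulr_sumr; apply: eq_bigr => z _; rewrite mulrA.
Qed.

Lemma law_add p m n x y : law p (m + n) x y = \sum_z law p m x z * law p n z y.
Proof. by rewrite /law addnC iterD -/(law p m x) iter_evolE. Qed.

Lemma evol_mass p f : (forall x, \sum_y p x y = 1) ->
  \sum_y evol p f y = \sum_x f x.
Proof.
move=> p1; rewrite /evol exchange_big; apply: eq_bigr => x _ /=.
by rewrite -mulr_sumr p1 mulr1.
Qed.

Lemma law_ge0 p n x y : (forall x y, 0 <= p x y) -> 0 <= law p n x y.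
Proof.
move=> p0; elim: n y => [|n IHn] y /=; first exact: ler0n.
by apply: sumr_ge0 => z _; apply: mulr_ge0.
Qed.

Lemma law_reversible p (m : X -> R) n x y :
  (forall x y, m x * p x y = m y * p y x) ->
  m x * law p n x y = m y * law p n y x.
Proof.
move=> rev; elim: n x y => [|n IHn] x y.
  by rewrite /law /point /= eq_sym; case: eqP => [->|]; rewrite ?mulr0.
transitivity (\sum_z m x * law p n x z * p z y).
  by rewrite /law /= /evol mulr_sumr; apply: eq_bigr => z _; rewrite mulrA.
rewrite -add1n law_add mulr_sumr; apply: eq_bigr => z _.
by rewrite IHn /law /= /evol sum_point mulrA -rev mulrAC.
Qed.

(** The defective distribution at time [t] of the walk from [x], on the event
that it avoids [y] at all times from 1 to [t]. The time 0 does not count, so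
that the mass seen at [y] at time [t.+1] is the probability that the first
passing time is [t.+1], also when [x = y]. *)
Fixpoint survival p (x y : X) (t : nat) : X -> R :=
  if t is t'.+1 then
    fun z => if z == y then 0 else evol p (survival p x y t') z
  else point x.

(** Split according to the time [s.+1] of the first passage at [y]. *)
Lemma law_renewal p x y t z :
  law p t x z = survival p x y t z +
    \sum_(s < t) evol p (survival p x y s) y * law p (t - s.+1) y z.
Proof.
elim: t z => [|t IHt] z; first by rewrite big_ord0 addr0.
transitivity (evol p (survival p x y t) z +
    \sum_(s < t) evol p (survival p x y s) y * law p (t.+1 - s.+1) y z).
  transitivity (\sum_u (survival p x y t u * p u z +
      \sum_(s < t) evol p (survival p x y s) y *
        (law p (t - s.+1) y u * p u z))).
    apply: eq_bigr => u _; rewrite [X in X * _ = _](IHt u) mulrDl mulr_suml.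
    by congr (_ + _); apply: eq_bigr => s _; rewrite mulrA.
  rewrite big_split exchange_big /=; congr (_ + _); apply: eq_bigr => s _.
  by rewrite -mulr_sumr subSn.
rewrite big_ord_recr /= subnn /law /= addrCA addrC; congr (_ + _).
rewrite /point; case: eqP => [->|_]; first by rewrite mulr1 add0r.
by rewrite mulr0 addr0.
Qed.

End Evolution.

(** A walk spreads over one edge per step: it is first seen at [y] exactly at
time [gdist e x y]. *)
Section Propagation.
Variables (R : realType) (X : finType) (e : rel X) (p : X -> X -> R).
Hypotheses (conn_e : forall x y : X, connect e x y).
Hypotheses (p_ge0 : forall x y, 0 <= p x y).
Hypotheses (p_gt0 : forall x y, e x y -> 0 < p x y).
Hypotheses (p_local : forall x y, ~~ adj_or_eq e x y -> p x y = 0).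

Lemma law_lt_gdist n x y : (n < gdist e x y)%N -> law p n x y = 0.
Proof.
elim: n y => [|n IHn] y dxy.
  rewrite /law /= /point; case: eqP dxy => // ->.
  by have [] := @gdist_le_path X e x [::] isT; rewrite /= leqn0 => /eqP->.
rewrite /law /= /evol big1 // => z _.
have [ezy|/p_local->] := boolP (adj_or_eq e z y); last by rewrite mulr0.
rewrite -/(law p n x) IHn ?mul0r // -ltnS.
by apply: leq_trans dxy _; exact: gdist_adj.
Qed.

Lemma law_path_gt0 x s : path e x s -> 0 < law p (size s) x (last x s).
Proof.
elim/last_ind: s => [|s y IHs]; first by rewrite /law /point /= eqxx.
rewrite rcons_path last_rcons size_rcons => /andP[exs esy].
rewrite /law /= /evol (bigD1 (last x s)) //=; apply: ltr_wpDr.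
  by apply: sumr_ge0 => z _; apply: mulr_ge0 => //; exact: law_ge0.
by apply: mulr_gt0; [exact: IHs | exact: p_gt0].
Qed.

Lemma law_gdist_gt0 x y : 0 < law p (gdist e x y) x y.
Proof.
by have [s exs [<- <-]] := gdist_path conn_e x y; exact: law_path_gt0.
Qed.

End Propagation.

(** * Observable chains *)

(** What the identification of two chains needs to know of a graph with the
Two-Points Condition. The last two fields are isolation and separation; they
mention the distance only through the vanishing of transition probabilities,
which twins share. *)
Record observable (R : realType) (X : finType) (B : {set X}) (m : X -> R)
    (p : X -> X -> R) : Prop := Observable {
  obs_ge0 : forall x y, 0 <= p x y;
  obs_mass : forall x, \sum_y p x y = 1;
  obs_weight : forall x, 0 < m x;
  obs_reversible : forall x y, m x * p x y = m y * p y x;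
  obs_irreducible : forall x y, exists n, 0 < law p n x y;
  obs_isolate : forall (S : {set X}) x, x \in S -> exists b x0 n,
    [/\ b \in B, x0 \in S, 0 < law p n b x0 &
        forall y, y \in S -> y != x0 -> law p n b y = 0];
  obs_separate : forall x f,
    (forall b n, b \in B -> (forall k, (k <= n)%N -> law p k x b = 0) ->
       iter n (evol p) f b = 0) ->
    f = (fun y => f x * point R x y) }.

(** * The inner product that makes a reversible chain self-adjoint *)

Definition inner (R : realType) (X : finType) (m f g : X -> R) : R :=
  \sum_x f x * g x / m x.

Section Inner.
Variables (R : realType) (X : finType) (m : X -> R).
Implicit Types f g h : X -> R.

Lemma inner_lin a f g h :
  inner m (fun x => a * f x + g x) h = a * inner m f h + inner m g h.
Proof.
rewrite /inner mulr_sumr -big_split /=; apply: eq_bigr => x _.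
by rewrite !mulrDl !mulrA.
Qed.

Lemma inner_point x f : inner m (point R x) f = f x / m x.
Proof.
rewrite -[RHS](sum_point x (fun x => f x / m x)).
by apply: eq_bigr => y _; rewrite mulrA.
Qed.

Lemma inner_evol p f g : (forall x, 0 < m x) ->
    (forall x y, m x * p x y = m y * p y x) ->
  inner m (evol p f) g = inner m f (evol p g).
Proof.
move=> m0 rev; rewrite /inner /evol.
transitivity (\sum_x \sum_y f y * p y x * g x / m x).
  by apply: eq_bigr => x _; rewrite !mulr_suml.
rewrite exchange_big; apply: eq_bigr => x _.
rewrite mulr_sumr mulr_suml; apply: eq_bigr => y _ /=.
have [mx my] := (lt0r_neq0 (m0 x), lt0r_neq0 (m0 y)).
have -> : p y x = m x * p x y / m y by rewrite rev mulrC mulKf.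
by field; rewrite mx my.
Qed.

Lemma inner_eq0 f : (forall x, 0 < m x) -> inner m f f = 0 -> f = (fun=> 0).
Proof.
move=> m0 /eqP; rewrite psumr_eq0; last first.
  by move=> x _; apply: divr_ge0; [rewrite -expr2 sqr_ge0 | exact: ltW].
move=> /allP f0; apply/funext => x.
have := f0 x (mem_index_enum x).
by rewrite mulf_eq0 mulf_eq0 orbb invr_eq0 (gt_eqF (m0 x)) orbF => /eqP.
Qed.

End Inner.

(** * Twins *)

Section Twin.
Variables (R : realType) (I : Type) (X X' : finType).
Variables (i_ : I -> X) (i'_ : I -> X').
Variables (p : X -> X -> R) (p' : X' -> X' -> R).

(** The linear span of the pairs of distributions that corresponding observers
produce. Being inductive, it needs neither a basis nor a common indexing of the
linear combinations, and it is visibly symmetric. That it is a function is a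
consequence of [twin_inner]. *)
Inductive twin : (X -> R) -> (X' -> R) -> Prop :=
| twin_point i : twin (point R (i_ i)) (point R (i'_ i))
| twin_evol f f' : twin f f' -> twin (evol p f) (evol p' f')
| twin0 : twin (fun=> 0) (fun=> 0)
| twin_lin a f f' g g' : twin f f' -> twin g g' ->
    twin (fun x => a * f x + g x) (fun x => a * f' x + g' x).

Lemma twin_law n i : twin (law p n (i_ i)) (law p' n (i'_ i)).
Proof. by elim: n => [|n IHn]; [exact: twin_point | exact: twin_evol]. Qed.

Lemma twinZ a f f' : twin f f' -> twin (fun x => a * f x) (fun x => a * f' x).
Proof.
move=> /(@twin_lin a) /(_ twin0); congr twin; apply/funext => x; exact: addr0.
Qed.

Lemma twin_sum (S : {set X}) (a : X -> R) (F : X -> X' -> R) :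
    (forall x, x \in S -> twin (point R x) (F x)) ->
  twin (fun y => \sum_(x in S) a x * point R x y)
       (fun y => \sum_(x in S) a x * F x y).
Proof.
move=> tF.
have : forall s : seq X, {subset s <= S} ->
  twin (fun y => \sum_(x <- s) a x * point R x y)
       (fun y => \sum_(x <- s) a x * F x y).
  elim=> [_|x s IHs sS].
    under eq_fun do rewrite big_nil.
    by under [X in twin _ X]eq_fun do rewrite big_nil; exact: twin0.
  under eq_fun do rewrite big_cons.
  under [X in twin _ X]eq_fun do rewrite big_cons.
  apply: twin_lin; first by apply: tF; apply: sS; exact: mem_head.
  by apply: IHs => y ys; apply: sS; rewrite inE ys orbT.
move=> /(_ (enum S)); under eq_fun do rewrite big_enum.
under [X in twin _ X]eq_fun do rewrite big_enum.
by apply=> x; rewrite mem_enum.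
Qed.

(** At a time when the walk from [b] charges [x0] and no other vertex of [S],
its distribution is a multiple of the unit mass at [x0], up to unit masses
outside [S]. *)
Lemma point_residue (S : {set X}) (b : X) n x0 : x0 \in S ->
  law p n b x0 != 0 -> (forall y, y \in S -> y != x0 -> law p n b y = 0) ->
  point R x0 = (fun y => (law p n b x0)^-1 *
    (-1 * \sum_(x in ~: S) law p n b x * point R x y + law p n b y)).
Proof.
move=> x0S l0 lS; apply/funext => y.
have [yS|yS] := boolP (y \in S).
  rewrite big1 ?mulr0 ?add0r; last first.
    move=> x; rewrite inE /point; case: eqP => [<-|_]; last by rewrite mulr0.
    by rewrite yS.
  rewrite /point; case: eqP => [->|/eqP yx0]; first by rewrite mulVf.
  by rewrite (lS y yS yx0) mulr0.
rewrite (bigD1 y) ?inE //= big1 ?addr0; last first.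
  by move=> x /andP[_ yx]; rewrite /point eq_sym (negPf yx) mulr0.
rewrite /point eqxx mulr1 mulN1r addNr mulr0.
by case: eqP yS => // ->; rewrite x0S.
Qed.

(** The expansion of [point_residue] only involves distributions that have
twins. *)
Lemma twin_residue (S : {set X}) (F : X -> X' -> R) i n x0 :
    (forall x, x \notin S -> twin (point R x) (F x)) ->
    x0 \in S -> law p n (i_ i) x0 != 0 ->
    (forall y, y \in S -> y != x0 -> law p n (i_ i) y = 0) ->
  twin (point R x0) (fun y => (law p n (i_ i) x0)^-1 *
    (-1 * \sum_(x in ~: S) law p n (i_ i) x * F x y + law p' n (i'_ i) y)).
Proof.
move=> tF x0S l0 lS; rewrite (point_residue x0S l0 lS).
apply: twinZ; apply: twin_lin; last exact: twin_law.
by apply: twin_sum => x; rewrite inE; exact: tF.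
Qed.

(** Isolation, applied to the set of vertices whose unit mass has no twin,
produces a twin for one of them. *)
Lemma twin_total (B : {set X}) m : observable B m p ->
    (forall b, b \in B -> exists i, i_ i = b) ->
  forall x, exists f', twin (point R x) f'.
Proof.
move=> obs iB.
have [F tF] : {F : X -> X' -> R &
    forall x, (exists f', twin (point R x) f') -> twin (point R x) (F x)}.
  apply: (@choice _ _ (fun x g => (exists f', twin (point R x) f') ->
    twin (point R x) g)) => x.
  have [[f' tf]|nt] := pselect (exists f', twin (point R x) f').
    by exists f'.
  by exists (fun=> 0) => /nt.
move=> x; apply: contrapT => nx.
pose S := [set x | `[< ~ exists f', twin (point R x) f' >]]%SET.
have [|b [x0 [n [bB x0S l0 lS]]]] := @obs_isolate _ _ _ _ _ obs S x.
  by rewrite inE; apply/asboolP.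
have [i ib] := iB b bB; rewrite -ib in l0 lS.
have : x0 \in S by [].
rewrite inE => /asboolP; apply.
eexists; apply: (twin_residue (F := F)) (x0S) (lt0r_neq0 l0) lS => y.
by rewrite inE => /asboolPn/contrapT /tF.
Qed.

Hypothesis same_law :
  forall i j n, law p n (i_ i) (i_ j) = law p' n (i'_ i) (i'_ j).

Lemma twin_observe f f' : twin f f' ->
  forall n j, iter n (evol p) f (i_ j) = iter n (evol p') f' (i'_ j).
Proof.
elim=> {f f'} [i n j|f f' _ IH n j|n j|a f f' g g' _ IHf _ IHg n j].
- exact: same_law.
- by rewrite -!iterSr IH.
- by rewrite !iter_evolE !big1 // => *; rewrite mul0r.
- by rewrite !iter_evol_lin IHf IHg.
Qed.

Lemma twin_mass f f' : (forall x, \sum_y p x y = 1) ->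
  (forall x, \sum_y p' x y = 1) -> twin f f' -> \sum_x f x = \sum_x f' x.
Proof.
move=> p1 p1'; elim=> {f f'} [i|f f' _ IH||a f f' g g' _ IHf _ IHg].
- by rewrite !mass_point.
- by rewrite !evol_mass.
- by rewrite !big1.
- by rewrite !big_split /= -!mulr_sumr IHf IHg.
Qed.

(** Both evolutions are self-adjoint, so the scalar product can be moved onto
observers, where it is an observation. *)
Lemma twin_inner m m' A f f' g g' :
    (forall x, 0 < m x) -> (forall x, 0 < m' x) -> A != 0 ->
    (forall x y, m x * p x y = m y * p y x) ->
    (forall x y, m' x * p' x y = m' y * p' y x) ->
    (forall i, m' (i'_ i) = A * m (i_ i)) ->
  twin f f' -> twin g g' -> inner m f g = A * inner m' f' g'.
Proof.
move=> m0 m'0 A0 rev rev' mA tf; elim: tf g g' => {f f'}.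
- move=> i g g' tg; rewrite !inner_point mA.
  have /= -> := twin_observe tg 0 i; have mi := lt0r_neq0 (m0 (i_ i)).
  by field; rewrite mi A0.
- by move=> f f' _ IH g g' tg; rewrite !inner_evol // (IH _ _ (twin_evol tg)).
- by move=> g g' _; rewrite /inner !big1 ?mulr0 // => *; rewrite !mul0r.
- move=> a f f' h h' _ IHf _ IHh g g' tg.
  by rewrite !inner_lin (IHf _ _ tg) (IHh _ _ tg) mulrDr mulrCA.
Qed.

End Twin.

Lemma twinC R I X X' i_ i'_ p p' f f' :
  @twin R I X X' i_ i'_ p p' f f' -> twin i'_ i_ p' p f' f.
Proof.
by elim=> *; [exact: twin_point|exact: twin_evol|exact: twin0|exact: twin_lin].
Qed.

(** * Unit masses are twins of unit masses *)

Section Matching.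
Variables (R : realType) (I : Type) (X X' : finType).
Variables (i_ : I -> X) (i'_ : I -> X').
Variables (p : X -> X -> R) (p' : X' -> X' -> R) (m : X -> R) (m' : X' -> R).
Variables (B : {set X}) (B' : {set X'}) (A : R).
Hypotheses (obs : observable B m p) (obs' : observable B' m' p').
Hypotheses (iB : forall b, b \in B -> exists i, i_ i = b).
Hypotheses (i'B : forall b, b \in B' -> exists i, i'_ i = b).
Hypothesis same_law :
  forall i j n, law p n (i_ i) (i_ j) = law p' n (i'_ i) (i'_ j).
Hypotheses (A_neq0 : A != 0) (mA : forall i, m' (i'_ i) = A * m (i_ i)).

Local Notation twins := (twin i_ i'_ p p').

Lemma twins_inner f f' g g' : twins f f' -> twins g g' ->
  inner m f g = A * inner m' f' g'.
Proof.
exact: (twin_inner same_law (obs_weight obs) (obs_weight obs') A_neq0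
  (obs_reversible obs) (obs_reversible obs') mA).
Qed.

Lemma twins_mass f f' : twins f f' -> \sum_x f x = \sum_x f' x.
Proof. exact: (twin_mass (obs_mass obs) (obs_mass obs')). Qed.

(** The difference of two twins of [f] is a twin of 0, hence has norm 0. *)
Lemma twins_fun f f' g' : twins f f' -> twins f g' -> f' = g'.
Proof.
move=> tf tg; have := twin_lin (-1) tg tf.
rewrite (_ : (fun x => -1 * f x + f x) = fun=> 0); last first.
  by apply/funext => x; rewrite mulN1r addNr.
move=> t0; have := twins_inner t0 t0.
rewrite /inner big1; last by move=> *; rewrite !mul0r.
move=> /esym/eqP; rewrite mulf_eq0 (negPf A_neq0) /= => /eqP.
move=> /(inner_eq0 (obs_weight obs')) h; apply/funext => x.
have := congr1 (@^~ x) h; rewrite mulN1r addrC => /eqP.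
by rewrite subr_eq0 => /eqP.
Qed.

(** If [g] charges [y], then, [g] being nonnegative, the unit mass at [y] is
invisible whenever [g] is. Separation then forces the twin of that unit mass to
be a multiple of the unit mass at [x], and the total mass fixes the factor. *)
Lemma twins_nonneg_point x g : twins (point R x) g -> (forall y, 0 <= g y) ->
  exists y, twins (point R x) (point R y).
Proof.
move=> tg g0.
have [y gy] : exists y, 0 < g y.
  apply: contrapT => ng; have := twins_mass tg.
  rewrite mass_point big1 => [/eqP|y _]; first by rewrite oner_eq0.
  apply/eqP; rewrite eq_le g0 andbT leNgt; apply/negP => gy.
  by apply: ng; exists y.
exists y; have [h th'] := twin_total i_ p obs' i'B y.
have th := twinC th'.
suff hE : h = fun z => h x * point R x z.
  have := twins_mass th; rewrite hE -mulr_sumr !mass_point mulr1 => hx.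
  by move: th; rewrite hE hx; under eq_fun do rewrite mul1r.
apply: (obs_separate obs) => b n bB l0; have [i ib] := iB bB.
rewrite -ib (twin_observe same_law th).
have := twin_observe same_law tg n i.
rewrite -/(law p n x) ib l0 // => /esym; rewrite iter_evolE => /eqP.
rewrite psumr_eq0; last first.
  by move=> z _; apply: mulr_ge0 => //; apply: law_ge0; exact: obs_ge0 obs'.
move=> /allP/(_ y (mem_index_enum y)) /=.
by rewrite mulf_eq0 gt_eqF //= => /eqP.
Qed.

(** The set [S] of unmatched vertices is empty: the twin [g] of the vertex [x0]
that isolation picks in it is nonnegative. *)
Lemma twins_match x : exists x', twins (point R x) (point R x').
Proof.
have [F tF] : {F : X -> X' -> R & forall x,
    (exists x', twins (point R x) (point R x')) ->
    twins (point R x) (F x) /\ exists x', F x = point R x'}.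
  apply: (@choice _ _ (fun x g => (exists x', twins (point R x) (point R x')) ->
    twins (point R x) g /\ exists x', g = point R x')) => z.
  have [[x' tx]|nt] := pselect (exists x', twins (point R z) (point R x')).
    by exists (point R x') => _; split=> //; exists x'.
  by exists (fun=> 0) => /nt.
apply: contrapT => nx.
pose S := [set x | `[< ~ exists x', twins (point R x) (point R x') >]]%SET.
have [|b [x0 [n [bB x0S l0 lS]]]] := @obs_isolate _ _ _ _ _ obs S x.
  by rewrite inE; apply/asboolP.
have [i ib] := iB bB; rewrite -ib in l0 lS.
have tS y : y \notin S ->
    twins (point R y) (F y) /\ exists x', F y = point R x'.
  by rewrite inE => /asboolPn/contrapT /tF.
have := twin_residue (F := F) (fun y yS => (tS y yS).1) x0S
  (lt0r_neq0 l0) lS.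
set g := (X in twin _ _ _ _ _ X) => tg.
have : x0 \in S by [].
rewrite inE => /asboolP; apply; apply: (twins_nonneg_point tg) => y'.
(* On the matched vertices g vanishes by orthogonality; off them it is a
   multiple of the law of the second walk. *)
have [[y yS yy']|ny'] := pselect (exists2 y, y \notin S & F y = point R y').
  have := twins_inner (tS y yS).1 tg.
  rewrite yy' !inner_point /point.
  case: eqP yS => [->|_ _]; first by rewrite x0S.
  rewrite mul0r => /esym/eqP; rewrite mulf_eq0 (negPf A_neq0) /=.
  rewrite mulf_eq0 invr_eq0 (gt_eqF (obs_weight obs' y')) orbF.
  by move=> /eqP->.
apply: mulr_ge0; first by rewrite invr_ge0 ltW.
rewrite big1; first by rewrite mulr0 add0r; apply: law_ge0; exact: obs_ge0 obs'.
move=> y; rewrite inE => yS; have [_ [z Fy]] := tS y yS.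
rewrite Fy /point; case: eqP => [y'z|]; last by rewrite mulr0.
by case: ny'; exists y; rewrite // Fy y'z.
Qed.

End Matching.

(** * Admissible walks under the Two-Points Condition *)

Section AdmissibleObservable.
Variables (R : realType) (X : finType) (e : rel X) (B : {set X}).
Variables (c p : X -> X -> R).
Hypotheses (graph_e : simple_graph e) (conn_e : connected_graph e).
Hypothesis adm : admissible e c p.
Local Notation m := (vertex_weight e c).

Lemma admissible_weight_gt0 x : 0 < m x. Proof. by case: adm. Qed.

Lemma admissible_edge_gt0 x y : e x y -> 0 < p x y.
Proof.
move=> exy; case: adm => cP _ m0 _ ->; last by rewrite /adj_or_eq exy.
by apply: divr_gt0 => //; case: (cP x y exy).
Qed.

Lemma admissible_ge0 x y : 0 <= p x y.
Proof.
have [|nxy] := boolP (adj_or_eq e x y); last by case: adm => _ _ _ ->.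
case/orP=> [/admissible_edge_gt0/ltW //|/eqP<-].
case: adm => _ c0 m0 _ ->; last by rewrite /adj_or_eq eqxx orbT.
by apply: divr_ge0; [exact: c0 | exact: ltW (m0 x)].
Qed.

Lemma admissible_mass x : \sum_y p x y = 1.
Proof.
case: adm => _ _ m0 pn pE; rewrite (bigID (adj_or_eq e x)) /=.
rewrite [X in _ + X]big1 ?addr0; last by move=> y /pn.
rewrite (eq_bigr (fun y => c x y / m x)); last by move=> y; exact: pE.
by rewrite -mulr_suml -/(m x) mulfV // lt0r_neq0.
Qed.

Lemma admissible_conductance x y : adj_or_eq e x y -> m x * p x y = c x y.
Proof.
case: adm => _ _ m0 _ pE xy; by rewrite pE // mulrC mulfVK // lt0r_neq0.
Qed.

Lemma admissible_reversible x y : m x * p x y = m y * p y x.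
Proof.
have [sym_e _] := graph_e.
have adjC : adj_or_eq e y x = adj_or_eq e x y.
  by rewrite /adj_or_eq sym_e eq_sym.
have [xy|nxy] := boolP (adj_or_eq e x y); last first.
  by case: adm => _ _ _ pn _; rewrite !pn ?mulr0 // adjC.
rewrite !admissible_conductance ?adjC //.
case/orP: xy => [exy|/eqP-> //].
by case: adm => cP _ _ _ _; case: (cP x y exy).
Qed.

Hypothesis tpc_e : two_points_condition e B.
Variable b0 : X.
Hypothesis b0B : b0 \in B.

Lemma exists_unique_nearest (S : {set X}) x : x \in S ->
  exists b x0, b \in B /\ unique_nearest e S b x0.
Proof.
move=> xS; have [/tpc_e|] := leqP 2 #|S|.
  case/card_gt1P=> x0 [_ [/existsP[b /andP[bB nx0]] _ _]].
  by exists b, x0.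
rewrite ltnS => S1; exists b0, x; split=> //; rewrite /unique_nearest xS.
apply/forall_inP => y yS; apply/implyP; rewrite (_ : y = x) ?eqxx //.
by apply: (card_le1_eqP S1).
Qed.

(** Isolation and separation both look from the observer [b], at the time equal
to its distance from the nearest point of [S]: all other points of [S] are
farther away, so that the walk has not joined them to [b] yet. *)
Lemma admissible_observable : observable B m p.
Proof.
have [[sym_e _] [_ conn]] := (graph_e, conn_e).
have local x y : ~~ adj_or_eq e x y -> p x y = 0.
  by case: adm => _ _ _ + _; exact.
have farE S b x0 y : unique_nearest e S b x0 -> y \in S -> y != x0 ->
    (gdist e b x0 < gdist e b y)%N.
  by move=> /andP[_ /forall_inP near] yS yx0; apply: (implyP (near y yS)).
split.
- exact: admissible_ge0.
- exact: admissible_mass.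
- exact: admissible_weight_gt0.
- exact: admissible_reversible.
- move=> x y; exists (gdist e x y).
  exact: (law_gdist_gt0 conn admissible_ge0 admissible_edge_gt0).
- move=> S x /exists_unique_nearest[b [x0 [bB near]]].
  exists b, x0, (gdist e b x0); split=> //; first by case/andP: near.
    exact: (law_gdist_gt0 conn admissible_ge0 admissible_edge_gt0).
  move=> y yS yx0; apply: (law_lt_gdist conn local).
  exact: farE near yS yx0.
- move=> x f f0; apply: contrapT => fx.
  have [y yx fy] : exists2 y, y != x & f y != 0.
    apply: contrapT => ny; apply: fx; apply/funext => y; rewrite /point.
    case: eqP => [->|/eqP yx]; first by rewrite mulr1.
    rewrite mulr0; apply: contrapT => /eqP fy; apply: ny; by exists y.
  pose S : {set X} := (x |: [set y | f y != 0])%SET.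
  have S2 : (2 <= #|S|)%N.
    apply/card_gt1P; exists x, y; rewrite !inE eqxx fy orbT; split=> //.
    by rewrite eq_sym.
  have [x1 x1x [b bB near]] : exists2 x1, x1 != x &
      exists2 b, b \in B & unique_nearest e S b x1.
    have /card_gt1P[u [v [/existsP[b /andP[bB ub]] ]]] := tpc_e S2.
    move=> /existsP[b' /andP[bB' vb]] uv.
    have [ux|ux] := eqVneq u x; last by exists u => //; exists b.
    by exists v; [rewrite -ux eq_sym | exists b'].
  have x1S : x1 \in S by case/andP: near.
  have xS : x \in S by rewrite !inE eqxx.
  have := f0 b (gdist e b x1) bB; rewrite iter_evolE (bigD1 x1) //= big1.
    rewrite addr0 => h; have : f x1 * law p (gdist e b x1) x1 b = 0.
      apply: h => k kx1; apply: (law_lt_gdist conn local).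
      rewrite (gdist_sym conn sym_e); apply: leq_ltn_trans kx1 _.
      by apply: (farE S) => //; rewrite eq_sym.
    have l0 := law_gdist_gt0 conn admissible_ge0 admissible_edge_gt0 x1 b.
    move/eqP; rewrite mulf_eq0 (gdist_sym conn sym_e b) (gt_eqF l0) orbF.
    by move: x1S; rewrite !inE (negPf x1x) /= => /negPf->.
  move=> z zx1; have [zS|] := boolP (z \in S).
    rewrite (law_lt_gdist conn local) ?mulr0 //.
    rewrite [gdist e z b](gdist_sym conn sym_e).
    exact: farE near zS zx1.
  by rewrite !inE negb_or negbK => /andP[_ /eqP->]; rewrite mul0r.
Qed.

End AdmissibleObservable.

(** * First passing times of a Markov chain *)

Lemma measure_finite_partition (R : realType) (d : measure_display)
    (T : measurableType d) (P : probability T R) (F : finType) (g : T -> F)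
    (A : set T) :
    (forall u, measurable [set w | g w = u]) -> measurable A ->
  P A = (\sum_u P (A `&` [set w | g w = u]))%E.
Proof.
move=> mg mA.
have consE u (s : seq F) :
    [set w | g w \in u :: s] = [set w | g w = u] `|` [set w | g w \in s].
  apply/seteqP; split=> w /=; rewrite inE.
    by case/orP=> [/eqP|]; [left | right].
  by case=> ->; rewrite ?eqxx ?orbT.
have mgs (s : seq F) : measurable [set w | g w \in s].
  elim: s => [|u s IHs]; last by rewrite consE; exact: measurableU.
  by rewrite (_ : [set w | _] = set0) // -subset0.
have Ps (s : seq F) : uniq s ->
    P (A `&` [set w | g w \in s]) =
    (\sum_(u <- s) P (A `&` [set w | g w = u]))%E.
  elim: s => [_|u s IHs /= /andP[us /IHs {}IHs]].
    rewrite big_nil (_ : _ `&` _ = set0) ?measure0 //.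
    by rewrite -subset0 => w [].
  rewrite big_cons -IHs consE setIUr measureU //; try exact: measurableI.
  by rewrite -subset0 => w [[_ /= gu] [_ /= gs]]; rewrite -gu gs in us.
rewrite -(Ps _ (index_enum_uniq F)); congr (P _).
by apply/seteqP; split=> [w Aw|w []//]; split=> //=; exact: mem_index_enum.
Qed.

Lemma first_passing_timeE (R : realType) (T : Type) (X : finType)
    (H : nat -> T -> X) (y : X) (w : T) (t : nat) :
  first_passing_time R H y w = t.+1%:R%:E <->
  (forall s, (0 < s <= t)%N -> H s w <> y) /\ H t.+1 w = y.
Proof.
pose D := [set s | (1 <= s)%N /\ H s w = y].
have least n : D n -> (forall s, D s -> (n <= s)%N) ->
    first_passing_time R H y w = n%:R%:E.
  move=> Dn nD; apply/eqP; rewrite eq_le; apply/andP; split.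
    by apply: ereal_inf_lbound; exists n.
  by apply: le_ereal_inf_tmp => _ [s /nD ns <-]; rewrite lee_fin ler_nat.
split=> [tauE|[av Hy]]; last first.
  apply: least => // s [s0 sy]; rewrite leqNgt; apply/negP => st.
  by apply: (av s) => //; rewrite s0.
have exD : exists s, `[< D s >].
  apply: contrapT => nD; move: tauE; rewrite /first_passing_time.
  suff -> : [set (s%:R%:E : \bar R) | s in D] = set0 by rewrite ereal_inf0.
  by rewrite -subset0 => r [s Ds _]; apply: nD; exists s; apply/asboolP.
have [n /asboolP Dn nmin] := ex_minnP exD.
have := least n Dn (fun s Ds => nmin s (introT (asboolP _) Ds)).
rewrite tauE => -[/eqP]; rewrite eqr_nat => /eqP tn.
case: Dn nmin; rewrite -tn => _ Hy nmin; split=> // s /andP[s0 st] sy.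
have /nmin : `[< D s >] by apply/asboolP.
by rewrite leqNgt ltnS st.
Qed.

Section PathLaw.
Variables (R : realType) (d : measure_display) (T : measurableType d).
Variables (P : probability T R) (X : finType) (p : X -> X -> R) (x0 : X).
Variable H : nat -> T -> X.
Hypothesis walk : markov_chain P p x0 H.

Let mH t y : measurable [set w | H t w = y]. Proof. by case: walk. Qed.

Definition past_event (t : nat) (E : set T) : Prop :=
  forall w w', (forall s, (s <= t)%N -> H s w = H s w') -> E w -> E w'.

(** The Markov property conditions on one trajectory; when that trajectory has
probability zero both sides vanish. *)
Lemma path_step t (h : nat -> X) z :
  let past := [set w | forall s, (s <= t)%N -> H s w = h s] in
  measurable past ->
  P (past `&` [set w | H t.+1 w = z]) = (P past * (p (h t) z)%:E)%E.
Proof.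
move=> past mpast; case: walk => _ _ markov step.
have mpz : measurable (past `&` [set w | H t.+1 w = z]) by exact: measurableI.
have [P0|P0] := eqVneq (P past) 0%E.
  rewrite P0 mul0e; apply/eqP; rewrite eq_le measure_ge0 andbT -P0.
  by apply: le_measure; rewrite ?inE //; exact: subIsetl.
have {}P0 : (0 < P past)%E by rewrite lt0e P0 measure_ge0.
have Pt0 : (0 < P [set w | H t w = h t])%E.
  apply: lt_le_trans P0 _; apply: le_measure; rewrite ?inE // => w.
  exact.
have := markov t h z P0; rewrite step // /cond_prob -/past setIC => <-.
have fP A : measurable A -> P A \is a fin_num by exact: fin_num_measure.
have Ppast0 : fine (P past) != 0.
  by rewrite gt_eqF // fine_gt0 // P0 /= -ge0_fin_numE ?measure_ge0 ?fP.
rewrite -[LHS](fineK (fP _ mpz)) -[X in (X * _)%E](fineK (fP _ mpast)) -EFinM.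
by rewrite mulrC divfK.
Qed.

(** An event of the past is a finite disjoint union of trajectories, so the
property of a single trajectory adds up. *)
Lemma markov_step t (E : set T) x z :
  measurable E -> past_event t E -> E `<=` [set w | H t w = x] ->
  P (E `&` [set w | H t.+1 w = z]) = (P E * (p x z)%:E)%E.
Proof.
move=> mE bE Ex.
(* The trajectory up to time t, as an element of a finite type. *)
pose g w : {ffun 'I_t.+1 -> X} := [ffun s => H (nat_of_ord s) w].
have gE u : [set w | g w = u] =
    [set w | forall s, (s <= t)%N -> H s w = u (inord s)].
  apply/seteqP; split=> w /=.
    by move=> <- s st; rewrite ffunE inordK.
  by move=> hs; apply/ffunP => s; rewrite ffunE hs ?inord_val // -ltnS.
have mg u : measurable [set w | g w = u].
  rewrite (_ : [set w | g w = u] =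
      \bigcap_(s in `I_t.+1) [set w | H s w = u (inord s)]).
    by apply: bigcap_measurableType => s _; exact: mH.
  by rewrite gE; apply/seteqP; split=> w hw s st; apply: (hw s).
rewrite (measure_finite_partition P mg (measurableI _ _ mE (mH t.+1 z))).
rewrite (measure_finite_partition P mg mE) ge0_sume_distrl //.
apply: eq_bigr => u _.
have [[w0 Ew0 gw0]|nE] := pselect (exists2 w, E w & g w = u); last first.
  have e0 : E `&` [set w | g w = u] = set0.
    by rewrite -subset0 => w [Ew gw]; apply: nE; exists w.
  by rewrite setIAC e0 set0I measure0 mul0e.
have guE : E `&` [set w | g w = u] = [set w | g w = u].
  apply/setIidPr => w gw; apply: bE Ew0 => s st.
  have : g w0 (inord s) = g w (inord s) by rewrite gw0 gw.
  by rewrite !ffunE inordK.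
rewrite setIAC guE.
have -> : x = u (inord t).
  by have /= <- := Ex _ Ew0; rewrite -gw0 ffunE inordK.
by have := mg u; rewrite gE; exact: (@path_step t (fun s => u (inord s))).
Qed.

Let avoid y t := [set w | forall s, (0 < s <= t)%N -> H s w <> y].

Let m_avoid y t : measurable (avoid y t).
Proof.
rewrite (_ : avoid y t =
    \bigcap_(s in [set s | (0 < s <= t)%N]) ~` [set w | H s w = y]).
  by apply: bigcap_measurableType => s _; apply: measurableC; exact: mH.
by apply/seteqP; split=> w hw s hs; exact: hw.
Qed.

Lemma survival_law y t z :
  P (avoid y t `&` [set w | H t w = z]) = (survival p x0 y t z)%:E /\
  P (avoid y t `&` [set w | H t.+1 w = z]) = (evol p (survival p x0 y t) z)%:E.
Proof.
have next k :
    (forall x, P (avoid y k `&` [set w | H k w = x]) =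
               (survival p x0 y k x)%:E) ->
    forall z, P (avoid y k `&` [set w | H k.+1 w = z]) =
              (evol p (survival p x0 y k) z)%:E.
  move=> IH {}z.
  rewrite (measure_finite_partition P (mH k)); last exact: measurableI.
  rewrite /evol -sumEFin; apply: eq_bigr => x _.
  rewrite setIAC (@markov_step k _ x) ?IH ?EFinM //; first exact: measurableI.
  move=> w w' ww' [Aw /= <-].
  split=> [s /andP[s0 sk]|]; last by rewrite /= ww'.
  by rewrite -ww' //; apply: Aw; rewrite s0.
suff here :
    forall z, P (avoid y t `&` [set w | H t w = z]) = (survival p x0 y t z)%:E.
  by split; [exact: here | exact: next].
elim: t => [|t IHt] {}z /=.
  case: walk => _ H0 _ _; rewrite /point eq_sym; case: eqP => [<-|zx].
    rewrite (_ : _ `&` _ = setT) ?probability_setT //.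
    by rewrite -subTset => w _; split=> [[]|].
  rewrite (_ : _ `&` _ = set0) ?measure0 // -subset0 => w [_ /=].
  by rewrite H0.
case: eqP => [->|zy].
  rewrite (_ : _ `&` _ = set0) ?measure0 // -subset0 => w [aw /= Hy].
  by apply: (aw t.+1); rewrite ?ltnSn.
rewrite -next //; congr (P _); apply/seteqP; split=> w [aw Hz]; split=> // s.
  by move=> /andP[s0 st]; apply: aw; rewrite s0 ltnW.
move=> /andP[s0]; rewrite leq_eqVlt => /orP[/eqP->|st]; first by rewrite Hz.
by apply: aw; rewrite s0.
Qed.

Lemma first_passing_law y t :
  P [set w | first_passing_time R H y w = t.+1%:R%:E] =
  (evol p (survival p x0 y t) y)%:E.
Proof.
rewrite -(survival_law y t y).2; congr (P _).
by apply/seteqP; split=> w /(first_passing_timeE R).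
Qed.

End PathLaw.

(** Strong induction on the renewal equation: at [y] the survival term vanishes
and the remaining terms only involve earlier times. *)
Lemma first_passing_determines_law (R : realType) (I : eqType)
  (X : finType) (i_ : I -> X) (p : X -> X -> R)
  (d : measure_display) (T : measurableType d) (P : probability T R)
  (H : X -> nat -> T -> X)
  (X' : finType) (i'_ : I -> X') (p' : X' -> X' -> R)
  (d' : measure_display) (T' : measurableType d') (P' : probability T' R)
  (H' : X' -> nat -> T' -> X') :
    injective i_ -> injective i'_ ->
    (forall x0 : X, markov_chain P p x0 (H x0)) ->
    (forall x0 : X', markov_chain P' p' x0 (H' x0)) ->
    (forall i j (t : nat), (1 <= t)%N ->
     P [set w | first_passing_time R (H (i_ i)) (i_ j) w = t%:R%:E] =
     P' [set w | first_passing_time R (H' (i'_ i)) (i'_ j) w = t%:R%:E]) ->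
  forall i j n, law p n (i_ i) (i_ j) = law p' n (i'_ i) (i'_ j).
Proof.
move=> inj inj' walk walk' same i j n.
elim/ltn_ind: n i j => [[_ i j|n IHn i j]].
  by rewrite /law /point /= (inj_eq inj) (inj_eq inj').
rewrite (law_renewal p _ (i_ j)) (law_renewal p' _ (i'_ j)) /= !eqxx !add0r.
apply: eq_bigr => s _; rewrite subSS (IHn (n - s)%N) ?ltnS ?leq_subr //.
congr (_ * _); have := same i j s.+1 isT.
by rewrite (first_passing_law (walk _)) (first_passing_law (walk' _)) => -[].
Qed.

(** * Recovery of the graph and of the weights *)

(** A set of two vertices has an extreme point, which requires an observer. *)
Lemma no_observer_single_vertex (X : finType) (e : rel X) (B : {set X}) :
    connected_graph e -> two_points_condition e B -> (forall b, b \notin B) ->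
  exists x : X, forall y, y = x.
Proof.
move=> [X0 _] tpc nB; have /card_gt0P[x _] := X0.
exists x => y; apply/eqP/negPn/negP => yx.
have /tpc/card_gt1P[u [_ [/existsP[b /andP[bB _]] _ _]]] :
    (2 <= #|[set y; x]%SET|)%N by rewrite cards2 yx.
by have := nB b; rewrite bB.
Qed.

Theorem theorem1p5 (R : realType)
  (X : finType) (e : rel X) (B : {set X})
  (c p : X -> X -> R)
  (d : measure_display) (T : measurableType d) (P : probability T R)
  (H : X -> nat -> T -> X)
  (X' : finType) (e' : rel X') (B' : {set X'})
  (c' p' : X' -> X' -> R)
  (d' : measure_display) (T' : measurableType d') (P' : probability T' R)
  (H' : X' -> nat -> T' -> X')
  (Phi0 : {x : X | x \in B} -> {x' : X' | x' \in B'})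
  (graph_e : simple_graph e) (conn_e : connected_graph e)
  (tpc_e : two_points_condition e B)
  (adm : admissible e c p)
  (walk : forall x0 : X, markov_chain P p x0 (H x0))
  (graph_e' : simple_graph e') (conn_e' : connected_graph e')
  (tpc_e' : two_points_condition e' B')
  (adm' : admissible e' c' p')
  (walk' : forall x0 : X', markov_chain P' p' x0 (H' x0))
  (bij_Phi0 : bijective Phi0)
  (same_data : forall (x0 y : {x : X | x \in B}) (t : nat), (1 <= t)%N ->
     P [set w | first_passing_time R (H (val x0)) (val y) w = t%:R%:E] =
     P' [set w | first_passing_time R (H' (val (Phi0 x0))) (val (Phi0 y)) w
                 = t%:R%:E]) :
  exists (Phi : X -> X') (A : R),
    [/\ bijective Phi /\ (forall x y : X, e' (Phi x) (Phi y) = e x y),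
        forall b : {x : X | x \in B}, Phi (val b) = val (Phi0 b),
        0 < A,
        forall x y : X, e x y || (x == y) -> c' (Phi x) (Phi y) = A * c x y
      & forall x y : X, p' (Phi x) (Phi y) = p x y].
Proof.
have [Psi0 Phi0K Psi0K] := bij_Phi0.
pose m := vertex_weight e c; pose m' := vertex_weight e' c'.
have m_gt0 x : 0 < m x := admissible_weight_gt0 adm x.
have m'_gt0 x : 0 < m' x := admissible_weight_gt0 adm' x.
(* The diagonal of p aside, edges are the nonzero transition probabilities, and
   a weight is a transition probability times the vertex weight. *)
suff [Phi [A [bijPhi PhiB A0 mA pPhi]]] : exists (Phi : X -> X') (A : R),
    [/\ bijective Phi, forall b : {x : X | x \in B}, Phi (val b) = val (Phi0 b),
        0 < A, forall x, m' (Phi x) = A * m x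
      & forall x y, p' (Phi x) (Phi y) = p x y].
  have injPhi := bij_inj bijPhi.
  have edgeE (Y : finType) (f : rel Y) (k q : Y -> Y -> R) y z :
      simple_graph f -> admissible f k q -> f y z = (y != z) && (q y z != 0).
    move=> [_ irr] admf; have [fyz|nfyz] := boolP (f y z).
      rewrite gt_eqF ?(admissible_edge_gt0 admf) // andbT.
      by apply/esym; apply: contraTneq fyz => ->; rewrite irr.
    have [->|yz] := eqVneq y z; first by [].
    case: admf => _ _ _ -> //; first by rewrite eqxx.
    by rewrite /adj_or_eq negb_or nfyz.
  have ePhi x y : e' (Phi x) (Phi y) = e x y.
    rewrite (edgeE _ _ _ _ _ _ graph_e' adm') (edgeE _ _ _ _ _ _ graph_e adm).
    by rewrite (inj_eq injPhi) pPhi.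
  exists Phi, A; split=> // x y xy.
  rewrite -(admissible_conductance adm) // -(admissible_conductance adm').
    by rewrite -/(m x) -/(m' _) mA pPhi mulrA.
  by rewrite /adj_or_eq ePhi (inj_eq injPhi).
have [nB|[b0 b0B]] : (forall b, b \notin B) \/ exists b, b \in B.
- have [[b bB]|nb] := pselect (exists b, b \in B); first by right; exists b.
  by left=> b; apply/negP => bB; apply: nb; exists b.
- have nB' b : b \notin B'.
    apply/negP => bB; have := nB (val (Psi0 (exist _ b bB))).
    by rewrite (valP (Psi0 _)).
  have [x xE] := no_observer_single_vertex conn_e tpc_e nB.
  have [x' xE'] := no_observer_single_vertex conn_e' tpc_e' nB'.
  exists (fun=> x'), (m' x' / m x); split.
  + by exists (fun=> x) => y; [rewrite [RHS]xE | rewrite [RHS]xE'].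
  + by move=> b; have := nB (val b); rewrite (valP b).
  + exact: divr_gt0.
  + by move=> y; rewrite (xE y) divfK // lt0r_neq0.
  + move=> y z; rewrite (xE y) (xE z).
    have := admissible_mass adm x.
    rewrite (big_pred1 x) => [->|u]; last by rewrite /= (xE u) eqxx.
    have := admissible_mass adm' x'; rewrite (big_pred1 x') => [->|u] //.
    by rewrite /= (xE' u) eqxx.
pose I := {x : X | x \in B}.
pose i_ : I -> X := val; pose i'_ (i : I) := val (Phi0 i).
have inj' : injective i'_ by move=> i j /val_inj/(can_inj Phi0K).
have iB b : b \in B -> exists i, i_ i = b by move=> bB; exists (exist _ b bB).
have i'B b : b \in B' -> exists i, i'_ i = b.
  by move=> bB; exists (Psi0 (exist _ b bB)); rewrite /i'_ Psi0K.
have same := first_passing_determines_law (val_inj : injective i_) inj' walk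
  walk' same_data.
have obs := admissible_observable graph_e conn_e adm tpc_e b0B.
pose i0 : I := exist _ b0 b0B.
have obs' := admissible_observable graph_e' conn_e' adm' tpc_e'
  (valP (Phi0 i0)).
pose A := m' (i'_ i0) / m (i_ i0).
have A0 : 0 < A by exact: divr_gt0.
have An0 : A != 0 := lt0r_neq0 A0.
(* Reversibility expresses the ratio m (i_ i) / m (i_ i0) by transition
   probabilities between observers. *)
have mA i : m' (i'_ i) = A * m (i_ i).
  have [n l0] := obs_irreducible obs (i_ i0) (i_ i).
  have ml := law_reversible n (i_ i0) (i_ i) (obs_reversible obs).
  have ml' := law_reversible n (i'_ i0) (i'_ i) (obs_reversible obs').
  have l1 : law p n (i_ i) (i_ i0) != 0.
    apply: contraTneq l0 => l1; move/eqP: ml; rewrite l1 mulr0 mulf_eq0.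
    by rewrite (gt_eqF (m_gt0 _)) => /eqP ->; rewrite ltxx.
  apply: (mulIf l1); rewrite -mulrA -ml same -ml' same /A mulrA divfK //.
  exact: lt0r_neq0.
have sameC i j n : law p' n (i'_ i) (i'_ j) = law p n (i_ i) (i_ j) by [].
have mAC i : m (i_ i) = A^-1 * m' (i'_ i) by rewrite mA mulKf.
have [Phi tPhi] := choice (twins_match obs obs' iB i'B same An0 mA).
(* The inverse comes from the same argument with the two graphs exchanged. *)
have [Psi tPsi] :=
  choice (twins_match obs' obs i'B iB sameC (invr_neq0 An0) mAC).
have point_inj (Y : finType) : injective (@point R Y).
  move=> y z /(congr1 (@^~ y)); rewrite /point eqxx.
  by case: eqP => // _ /eqP; rewrite oner_eq0.
have tfun := twins_fun obs obs' same An0 mA.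
have tfunC := twins_fun obs' obs sameC (invr_neq0 An0) mAC.
have mPhi x : m' (Phi x) = A * m x.
  have := twins_inner obs obs' same An0 mA (tPhi x) (tPhi x).
  rewrite !inner_point /point !eqxx !mul1r => mm.
  by rewrite -[RHS]invrK invfM mm mulrA mulVf // mul1r invrK.
exists Phi, A; split=> //.
- exists Psi => x; apply: point_inj.
    exact: tfunC (tPsi (Phi x)) (twinC (tPhi x)).
  exact: tfun (tPhi (Psi x)) (twinC (tPsi x)).
- move=> b; apply: point_inj; apply: tfun (tPhi _) _.
  exact: (twin_point i_ i'_).
- move=> x y.
  have := twins_inner obs obs' same An0 mA (tPhi y) (twin_evol (tPhi x)).
  rewrite !inner_point /evol !sum_point -/m -/m' mPhi.
  have my := lt0r_neq0 (m_gt0 y).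
  move=> /(congr1 ( *%R^~ (m y))); rewrite divfK // => ->.
  by field; rewrite my An0.
Qed.
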